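(* Let $n,p$ be positive integers, assume that $\gamma\log p<n$ for some constant $\gamma>8$, and fix $C_0\ge 4$. Consider the threshold $$\tau=2C_0\sqrt{\frac{\gamma\log p}{n}},$$ and assume that $\tau\le 1$. Then, for any $q\in[0,2)$, any $R>0$ and any $\Sigma\in\mathcal{F}_q(R)$, the plug-in estimator $Q(\tilde\Sigma_\tau)$ satisfies $$\mathbb{E}\Big[\big(Q(\tilde\Sigma_\tau)-Q(\Sigma)\big)^2\Big]\le C_1\,\psi_{n,p}(q,R)+C_2\,p^{4-\gamma/2},$$ where $$\psi_{n,p}(q,R)=\frac{R^2}{n}\ \vee\ R^2\Big(\frac{\log p}{n}\Big)^{2-q},$$ and $C_1,C_2$ are positive constants depending only on $\gamma, C_0, q$.
   Context: $a\vee b=\max(a,b)$. $\mathbf{S}_p^+$ is the set of $p\times p$ real symmetric positive semi-definite matrices. For $q\in[0,2)$, $R>0$, $$\mathcal{F}_q(R)=\Big\{\Sigma=(\sigma_{ij})\in\mathbf{S}_p^+:\ \sum_{i\ne j}|\sigma_{ij}|^q\le R,\ \mathrm{diag}(\Sigma)=I_p\Big\},$$ where the sum is over ordered pairs $(i,j)\in\{1,\dots,p\}^2$ with $i\neq j$, $\mathrm{diag}(\Sigma)$ is $\Sigma$ with off-diagonal entries set to $0$, and for $q=0$, $|x|^0$ means $1$ if $x\ne0$ and $0$ if $x=0$. The observations $X_1,\dots,X_n$ are i.i.d. $\mathcal{N}(0,\Sigma)$ in $\mathbb{R}^p$, and $\mathbb{E}$ is expectation under this law. The empirical covariance matrix is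 $\hat\Sigma=\frac1n\sum_{k=1}^nX_kX_k^\top=(\hat\sigma_{ij})$. The thresholded matrix $\tilde\Sigma_\tau=(\tilde\sigma_{ij})$ is defined by $\tilde\sigma_{ij}=\hat\sigma_{ij}\mathbf{1}\{|\hat\sigma_{ij}|>\tau\}$ for $i\ne j$ and $\tilde\sigma_{ii}=\hat\sigma_{ii}$. For a matrix $A=(a_{ij})$, $Q(A)=\sum_{i\ne j}a_{ij}^2$. Thus $Q(\tilde\Sigma_\tau)=\sum_{i\ne j}\hat\sigma_{ij}^2\mathbf{1}\{|\hat\sigma_{ij}|>\tau\}$. *)

(* Defs.v *)
From mathcomp Require Import all_boot all_order all_algebra.
From mathcomp Require Import all_classical all_reals all_analysis.
Set Implicit Arguments.
Unset Strict Implicit.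
Unset Printing Implicit Defensive.
Import Order.TTheory GRing.Theory Num.Theory.
Import numFieldNormedType.Exports.
Local Open Scope classical_set_scope.
Local Open Scope ring_scope.

Section matrices.
Variables (R : realType) (p : nat).

Definition psdmx (A : 'M[R]_p) : Prop :=
  A^T = A /\ forall u : 'cV[R]_p, 0 <= (u^T *m A *m u) 0 0.

Definition diag_part (A : 'M[R]_p) : 'M[R]_p := \matrix_(i, j) (A i j *+ (i == j)).

(* [powR] has [0 `^ 0 = 1], whereas the sparsity count at q = 0 needs
   |0|^0 = 0. *)
Definition abs_pow (q x : R) : R :=
  if q == 0 then (x != 0)%:R else `|x| `^ q.

Definition sparse_class (q r : R) (S : 'M[R]_p) : Prop :=
  [/\ psdmx S,
      \sum_i \sum_(j | i != j) abs_pow q (S i j) <= r &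
      diag_part S = 1%:M].

Definition Qfun (A : 'M[R]_p) : R := \sum_i \sum_(j | i != j) A i j ^+ 2.

Definition threshold_mx (tau : R) (A : 'M[R]_p) : 'M[R]_p :=
  \matrix_(i, j) if (i == j) || (tau < `|A i j|) then A i j else 0.

Definition col_of_tuple (x : p.-tuple R) : 'cV[R]_p := \col_i tnth x i.

Definition empirical_cov (n : nat) (x : 'I_n -> p.-tuple R) : 'M[R]_p :=
  n%:R^-1 *: \sum_k (col_of_tuple (x k) *m (col_of_tuple (x k))^T).

End matrices.

Section probability.
Variables (d : measure_display) (T : measurableType d) (R : realType).
Variable P : probability T R.

(* The univariate normal law N(m, v), with v the variance; [normal_prob] takes
   the standard deviation and is not the point mass at m when this is 0. *)
Definition normal_law (m v : R) : set (measurableTypeR R) -> \bar R :=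
  if v == 0 then \d_m else normal_prob m (Num.sqrt v).

(* X ~ N(0, S), with S possibly singular: every linear form u^T X has law
   N(0, u^T S u). *)
Definition gaussian_vector (p : nat) (S : 'M[R]_p) (X : T -> p.-tuple R) : Prop :=
  forall (u : 'cV[R]_p) (B : set (measurableTypeR R)), measurable B ->
    pushforward P
      (fun w => (u^T *m col_of_tuple (X w)) 0 0 : measurableTypeR R) B =
    normal_law 0 ((u^T *m S *m u) 0 0) B.

Definition mutually_independent (I : finType) (d' : measure_display)
    (T' : measurableType d') (X : I -> T -> T') : Prop :=
  forall (J : {set I}) (B : I -> set T'), (forall i, measurable (B i)) ->
    (P (\bigcap_(i in [set` J]) (X i @^-1` B i)) =
     \prod_(i in J) P (X i @^-1` B i))%E.

Definition iid_gaussian (n p : nat) (S : 'M[R]_p)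
    (X : 'I_n -> T -> p.-tuple (measurableTypeR R)) : Prop :=
  mutually_independent X /\ forall k, gaussian_vector S (X k).

End probability.

Definition tau_np (R : realType) (gamma C0 : R) (n p : nat) : R :=
  2 * C0 * Num.sqrt (gamma * ln p%:R / n%:R).

Definition psi_np (R : realType) (q r : R) (n p : nat) : R :=
  Num.max (r ^+ 2 / n%:R) (r ^+ 2 * (ln p%:R / n%:R) `^ (2 - q)).

(* Main.v *)
(** Only the laws of the linear forms [X_i + X_j] and [X_i - X_j] matter: by
  polarization, [X_i X_j = ((X_i + X_j)^2 - (X_i - X_j)^2) / 4], and independence
  of the sample, they give [E exp (n l |dev|) <= 2 exp (8 n l^2)] for
  [0 <= l <= 1/16], where [dev] is the error of an entry of the empirical
  covariance.  Taking [l = 1 / (16 sqrt n)] yields [E dev^2 <= 4096 / n].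

  With [t = tau / 2] and [w] the [q]-th power of the modulus of the true entry,
  the error made on the square of that entry is, pathwise, at most
  [9 w t^(2-q) + 2 w |dev| + 16 exp (l n (|dev| - t) / 2)] with [l = t / 16]: the
  last term alone covers the event [|dev| > t], the first two the rest.  The
  weights sum to at most [r], so squaring the sum of the first two terms yields
  the rate [psi]; the square of the last has mean at most
  [2 exp (- n t^2 / 32) <= 2 p^(-gamma/2)] per entry, whence [p^(4-gamma/2)]. *)
Require Import Defs.
From mathcomp Require Import all_boot all_order all_algebra.
From mathcomp Require Import all_classical all_reals all_analysis.
From mathcomp Require Import measurable_realfun.
From mathcomp Require Import ring lra.
Set Implicit Arguments.
Unset Strict Implicit.
Unset Printing Implicit Defensive.
Import Order.TTheory GRing.Theory Num.Theory.
Import HBNNSimple.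
Local Open Scope classical_set_scope.
Local Open Scope ring_scope.

(** * Integrals of independent products *)

Lemma measurable_prod_cond d (T : measurableType d) (R : realType) (I : Type)
    (D : set T) (s : seq I) (Q : pred I) (h : I -> T -> R) :
    (forall i, measurable_fun D (h i)) ->
  measurable_fun D (fun x => \prod_(i <- s | Q i) h i x).
Proof.
move=> mh; elim: s => [|i s IH].
  by under eq_fun do rewrite big_nil; exact: measurable_cst.
under eq_fun do rewrite big_cons.
by case: (Q i) => //; exact: measurable_funM.
Qed.

Lemma measurable_sum_cond d (T : measurableType d) (R : realType) (I : Type)
    (D : set T) (s : seq I) (Q : pred I) (h : I -> T -> R) :
    (forall i, measurable_fun D (h i)) ->
  measurable_fun D (fun x => \sum_(i <- s | Q i) h i x).
Proof.
move=> mh; under eq_fun do rewrite big_mkcond.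
by apply: measurable_sum => i; case: (Q i) => //; exact: measurable_cst.
Qed.

(** Both sides are linear in [f] and continuous along increasing sequences, so indicators suffice:
    simple functions split into level sets, then monotone convergence applies on each side. The
    weight [g] and the map [phi] cover densities ([phi = id]), changes of variables ([g = 1]) and
    one factor of an independent product. *)
Lemma ge0_integral_density (R : realType) (dT dU : measure_display)
    (T : measurableType dT) (U : measurableType dU)
    (mu : {measure set T -> \bar R}) (nu : {measure set U -> \bar R})
    (g : T -> R) (phi : T -> U) (c : R) (f : U -> \bar R) :
    measurable_fun setT g -> (forall x, 0 <= g x) ->
    measurable_fun setT phi ->
    measurable_fun setT f -> (forall y, (0 <= f y)%E) ->
    (forall B, measurable B ->
       (\int[mu]_x (g x * \1_B (phi x))%:E = c%:E * nu B)%E) ->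
  (\int[mu]_x ((g x)%:E * f (phi x)) = c%:E * \int[nu]_y f y)%E.
Proof.
move=> mg g0 mphi mf f0 gB.
pose h := nnsfun_approx measurableT mf.
have hf y : (EFin \o h^~ y) n @[n --> \oo] --> f y by exact: cvg_nnsfun_approx.
have ndh y m n : (m <= n)%N -> h m y <= h n y.
  by move=> mn; exact/lefP/nd_nnsfun_approx.
have mh n : measurable_fun setT (h n) by exact: measurable_funP.
have lim_nu : (\int[nu]_y (h n y)%:E)%E @[n --> \oo] --> (\int[nu]_y f y)%E.
  rewrite (_ : (\int[nu]_y f y = \int[nu]_y limn (EFin \o h^~ y))%E); last first.
    by apply: eq_integral => y _; exact/esym/cvg_lim.
  apply: cvg_monotone_convergence => //.
  - by move=> n; exact/measurable_EFinP.
  - by move=> n y _; rewrite lee_fin.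
  - by move=> y _ m n mn; rewrite lee_fin ndh.
have lim_mu : (\int[mu]_x ((g x)%:E * (h n (phi x))%:E))%E @[n --> \oo] -->
              (\int[mu]_x ((g x)%:E * f (phi x)))%E.
  rewrite (_ : (\int[mu]_x ((g x)%:E * f (phi x)) =
      \int[mu]_x limn (fun n => (g x)%:E * (h n (phi x))%:E))%E); last first.
    apply: eq_integral => x _; apply/esym/cvg_lim => //.
    by apply: cvgeZl => //; exact: hf.
  apply: cvg_monotone_convergence => //.
  - move=> n; apply: emeasurable_funM; apply/measurable_EFinP => //.
    exact: measurableT_comp.
  - by move=> n x _; rewrite mule_ge0 ?lee_fin.
  - by move=> x _ m n mn; rewrite lee_wpmul2l ?lee_fin ?ndh.
apply: (@cvg_unique _ _ _ _ _ _ lim_mu) => //.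
rewrite (_ : (fun n => _) = (fun n => (c%:E * \int[nu]_y (h n y)%:E)%E)).
  by apply: cvgeZl.
apply/funext => n.
have mind r : measurable (h n @^-1` [set r]) by exact: measurable_funPTI.
have hE y : (h n y)%:E =
    (\sum_(r \in range (h n)) (r * \1_(h n @^-1` [set r]) y)%:E)%E.
  by rewrite fsumEFin// -fimfunE.
transitivity (\int[mu]_x (\sum_(r \in range (h n))
    (r * (g x * \1_(h n @^-1` [set r]) (phi x)))%:E))%E.
  apply: eq_integral => x _; rewrite hE ge0_mule_fsumr; last first.
    by move=> r; exact: nnfun_muleindic_ge0.
  by apply: eq_fsbigr => r _; rewrite -EFinM mulrCA.
have mphiI r : measurable_fun setT (fun x => g x * \1_(h n @^-1` [set r]) (phi x)).
  by apply: measurable_funM => //; exact: measurableT_comp.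
rewrite ge0_integral_fsum//; last 2 first.
  - move=> r; apply/measurable_EFinP; exact: measurable_funM.
  - move=> r x _; rewrite mulrCA EFinM mule_ge0 ?lee_fin//.
    by rewrite -lee_fin; exact: nnfun_muleindic_ge0.
under [in RHS]eq_integral do rewrite hE.
rewrite ge0_integral_fsum//; last 2 first.
  - by move=> r; apply/measurable_EFinP; exact: measurable_funM.
  - by move=> r y _; exact: nnfun_muleindic_ge0.
rewrite ge0_mule_fsumr; last first.
  by move=> r; apply: integral_ge0 => y _; exact: nnfun_muleindic_ge0.
apply: eq_fsbigr => r; rewrite inE => -[y _ <-].
under eq_integral do rewrite EFinM.
rewrite ge0_integralZl ?lee_fin//; last 2 first.
  - exact/measurable_EFinP.
  - by move=> x _; rewrite lee_fin mulr_ge0.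
rewrite gB//; under [in RHS]eq_integral do rewrite EFinM.
rewrite ge0_integralZl ?lee_fin//; last exact/measurable_EFinP.
by rewrite integral_indic// setIT muleCA.
Qed.

(* The functions replace the indicators one index at a time: for fixed values of
   the other factors, the identity for all events on [X j] says that those
   factors form a density with respect to the law of [X j]. *)
Lemma ge0_integral_indep_prod (R : realType) (d d' : measure_display)
    (T : measurableType d) (T' : measurableType d') (P : probability T R)
    (I : finType) (X : I -> {RV P >-> T'}) (f : I -> T' -> R) (m : I -> R) :
    mutually_independent P X ->
    (forall i, measurable_fun setT (f i)) -> (forall i y, 0 <= f i y) ->
    (forall i, (\int[P]_w (f i (X i w))%:E = (m i)%:E)%E) ->
  (\int[P]_w (\prod_i f i (X i w))%:E = (\prod_i m i)%:E)%E.
Proof.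
move=> indX mf f0 fm.
(* Induction on the cardinality of [J], the set of indices whose indicator is already replaced by
   its function. The empty [J] is independence itself; the full set is the goal. *)
have claim (J : {set I}) (B : I -> set T') : (forall i, measurable (B i)) ->
    (\int[P]_w (\prod_i (if i \in J then f i (X i w) else \1_(B i) (X i w)))%:E =
     (\prod_i (if i \in J then m i else fine (P (X i @^-1` B i))))%:E)%E.
  move: {2}#|J| (erefl #|J|) => k; elim: k J B => [|k IH] J B cardJ mB.
    have -> : J = finset.set0 by apply: cards0_eq.
    have mXB i : measurable (X i @^-1` B i) by exact: measurable_funPTI.
    pose C := \bigcap_(i in [set` [set: I]%SET]) (X i @^-1` B i).
    transitivity (\int[P]_w (\1_C w)%:E)%E.
      apply: eq_integral => w _; congr (_%:E); rewrite /C.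
      have -> : [set` [set: I]%SET] = [set: I] :> set I.
        by apply/seteqP; split => x //= _; rewrite finset.inE.
      rewrite indicE; case: (pselect (forall i, B i (X i w))) => [Bw|nBw].
        rewrite big1 => [|i _]; last by rewrite finset.inE indicE mem_set//; exact: Bw.
        by rewrite mem_set// => i _; exact: Bw.
      have /existsNP[i nBi] := nBw.
      rewrite (bigD1 i)//= finset.inE indicE memNset// mul0r memNset//.
      by move=> /(_ i Logic.I).
    rewrite integral_indic//; last by apply: fin_bigcap_measurable.
    rewrite setIT [LHS]indX// -prodEFin.
    by apply: eq_big => i; rewrite ?finset.inE // fineK// fin_num_measure.
  have /card_gt0P[j jJ] : (0 < #|J|)%N by rewrite cardJ.
  have cardK : #|J :\ j|%SET = k by move: cardJ; rewrite (cardsD1 j) jJ => -[].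
  have inK i : i != j -> (i \in J :\ j)%SET = (i \in J) by rewrite finset.in_setD1 => ->.
  pose g w := \prod_(i | i != j)
    (if i \in J then f i (X i w) else \1_(B i) (X i w)).
  pose c := \prod_(i | i != j)
    (if i \in J then m i else fine (P (X i @^-1` B i))).
  have mg : measurable_fun setT g.
    apply: measurable_prod_cond => i; case: (i \in J); first exact: measurableT_comp.
    by apply: measurableT_comp.
  have g0 w : 0 <= g w by apply: prodr_ge0 => i _; case: ifP.
  under eq_integral do rewrite (bigD1 j)//= jJ mulrC EFinM.
  rewrite (bigD1 j)//= jJ mulrC EFinM -/c -fm.
  rewrite -(ge0_integral_distribution (X j) (f := fun y => (f j y)%:E)); last 2 first.
  - exact/measurable_EFinP.
  - by move=> y; rewrite lee_fin.
  apply: (@ge0_integral_density _ _ _ _ _ P (distribution P (X j)) g (X j) c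
    (fun y => (f j y)%:E)) => //.
  - exact/measurable_EFinP.
  - by move=> y; rewrite lee_fin.
  (* Putting the indicator of [C] at index [j] turns the integrand into an instance of the claim for
     [J] without [j]. *)
  move=> C mC.
  have mB' i : measurable (if i == j then C else B i) by case: ifP.
  transitivity (\int[P]_w (\prod_i (if i \in (J :\ j)%SET then f i (X i w)
      else \1_(if i == j then C else B i) (X i w)))%:E)%E.
    apply: eq_integral => w _.
    rewrite [in RHS](bigD1 j)//= finset.in_setD1 eqxx/= mulrC.
    by congr (_ * _)%:E; apply: eq_bigr => i ij; rewrite inK// (negbTE ij).
  rewrite (IH _ (fun i => if i == j then C else B i))//.
  rewrite (bigD1 j)//= finset.in_setD1 eqxx/= mulrC EFinM.
  congr (_ * _)%E; last by rewrite fineK// fin_num_measure//; exact: measurable_funPTI.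
  by congr (_%:E); apply: eq_bigr => i ij; rewrite inK// (negbTE ij).
have := claim [set: I]%SET (fun=> setT) (fun=> measurableT).
under eq_integral do under eq_bigr do rewrite finset.inE.
by under [X in _ = X%:E]eq_bigr do rewrite finset.inE.
Qed.

(** * Quadratic exponential moments of Gaussian variables *)

(** The quadratic exponents add up to that of a centred normal of variance [s^2 / (1 - 2 a s^2)];
    the scalar factor is the ratio of the two peaks. *)
Lemma normal_pdf_tilt (R : realType) (s a x : R) : s != 0 -> 2 * a * s ^+ 2 < 1 ->
  normal_pdf 0 s x * expR (a * x ^+ 2) =
  (Num.sqrt (1 - 2 * a * s ^+ 2))^-1 *
    normal_pdf 0 (s / Num.sqrt (1 - 2 * a * s ^+ 2)) x.
Proof.
move=> s0 as1; set c := 1 - 2 * a * s ^+ 2.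
have c0 : 0 < c by rewrite subr_gt0.
have r0 : Num.sqrt c != 0 by rewrite gt_eqF// sqrtr_gt0.
have r2 : Num.sqrt c ^+ 2 = c by rewrite sqr_sqrtr// ltW.
rewrite !normal_pdfE//; last by rewrite mulf_neq0// invr_eq0.
rewrite -[LHS]mulrA [RHS]mulrA; congr (_ * _).
  rewrite /normal_peak exprMn exprVn r2.
  rewrite (_ : s ^+ 2 / c * pi *+ 2 = c^-1 * (s ^+ 2 * pi *+ 2)); last by ring.
  rewrite sqrtrM ?invr_ge0 ?(ltW c0)// sqrtrV ?(ltW c0)//.
  by rewrite invfM invrK mulrA mulVf// mul1r.
rewrite /normal_fun -expRD subr0 exprMn exprVn r2 /c; congr expR.
field.
by rewrite s0 -/c gt_eqF.
Qed.

Lemma measurable_expR_sqr (R : realType) (a : R) :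
  measurable_fun [set: R] (fun x : R => expR (a * x ^+ 2)).
Proof.
by apply: measurableT_comp => //; apply: measurable_funM => //; exact: measurable_funX.
Qed.

Lemma integral_normal_prob_expR_sqr (R : realType) (s a : R) :
    s != 0 -> 2 * a * s ^+ 2 < 1 ->
  (\int[normal_prob 0 s]_x (expR (a * x ^+ 2))%:E =
   ((Num.sqrt (1 - 2 * a * s ^+ 2))^-1)%:E)%E.
Proof.
move=> s0 as1; have mexp := @measurable_expR_sqr R a.
rewrite -[LHS]mul1e.
rewrite -(@ge0_integral_density _ _ _ _ _ lebesgue_measure
  (normal_prob 0 s) (normal_pdf 0 s) id 1
  (fun x => (expR (a * x ^+ 2))%:E))//; last 4 first.
- exact: measurable_normal_pdf.
- by move=> x; exact: normal_pdf_ge0.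
- exact/measurable_EFinP.
- move=> B mB; rewrite mul1e /normal_prob [RHS]integral_mkcond.
  by apply: eq_integral => x _; rewrite epatch_indic EFinM.
under eq_integral do rewrite -EFinM normal_pdf_tilt// EFinM.
rewrite ge0_integralZl ?lee_fin ?invr_ge0 ?sqrtr_ge0//; last 2 first.
- by apply/measurable_EFinP; exact: measurable_normal_pdf.
- by move=> x _; rewrite lee_fin normal_pdf_ge0.
by rewrite integral_normal_pdf mule1.
Qed.

Lemma integral_gaussian_expR_sqr (R : realType) (d : measure_display)
    (T : measurableType d) (P : probability T R) (Z : T -> R) (v a : R) :
    measurable_fun setT Z ->
    (forall B : set (measurableTypeR R), measurable B ->
       pushforward P (Z : T -> measurableTypeR R) B = normal_law 0 v B) ->
    0 <= v -> 2 * a * v < 1 ->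
  (\int[P]_w (expR (a * Z w ^+ 2))%:E = ((Num.sqrt (1 - 2 * a * v))^-1)%:E)%E.
Proof.
move=> mZ lawZ v0 av1.
have mexp : measurable_fun setT (fun x : measurableTypeR R => (expR (a * x ^+ 2))%:E).
  by apply/measurable_EFinP; exact: measurable_expR_sqr.
have transfer (nu : {measure set (measurableTypeR R) -> \bar R}) :
    (forall B, measurable B -> normal_law 0 v B = nu B) ->
    (\int[P]_w (expR (a * Z w ^+ 2))%:E = \int[nu]_x (expR (a * x ^+ 2))%:E)%E.
  move=> lawE; rewrite -[RHS]mul1e.
  rewrite -(@ge0_integral_density _ _ _ _ (measurableTypeR R) P nu (cst 1) Z)//.
    by apply: eq_integral => w _; rewrite mul1e.
  move=> B mB; rewrite mul1e -lawE// -lawZ//.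
  transitivity (\int[P]_w (\1_(Z @^-1` B) w)%:E)%E.
    by apply: eq_integral => w _; rewrite mul1r.
  by rewrite integral_indic ?setIT// -[_ @^-1` _]setTI; exact: mZ.
move: transfer; rewrite /normal_law; case: eqVneq => [->|vneq0] transfer.
  (* In the degenerate case the law is the point mass at 0 and both sides equal 1. *)
  rewrite (transfer (dirac (0 : measurableTypeR R)))// integral_dirac//.
  by rewrite diracT mul1e !mulr0 expr0n mulr0 expR0 subr0 sqrtr1 invr1.
have s0 : Num.sqrt v != 0 by rewrite gt_eqF// sqrtr_gt0 lt0r vneq0.
have s2 : Num.sqrt v ^+ 2 = v by rewrite sqr_sqrtr.
by rewrite (transfer (normal_prob 0 (Num.sqrt v)))// integral_normal_prob_expR_sqr ?s2.
Qed.

(** The left side is the mean of [exp (x (Z^2 - 1))] for [Z] standard normal. After squaring,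
    [1 + u <= exp u] at [u = 2 x^2 + x] reduces the bound to a polynomial inequality. *)
Lemma chi2_mgf_bound (R : realType) (x : R) : `|x| <= 8^-1 ->
  (Num.sqrt (1 - 2 * x))^-1 * expR (- x) <= expR (2 * x ^+ 2).
Proof.
move=> /ler_normlP[x1 x2].
have w0 : 0 <= 1 + (2 * x ^+ 2 + x) by nra.
have c0 : 0 < 1 - 2 * x by lra.
have H : 1 <= (1 - 2 * x) * (1 + (2 * x ^+ 2 + x)) ^+ 2.
  have -> : (1 - 2 * x) * (1 + (2 * x ^+ 2 + x)) ^+ 2 =
     1 + x ^+ 2 * (1 - 6 * x - 4 * x ^+ 2 - 8 * x ^+ 3) by ring.
  (* For [|x| <= 1/8] the last factor is at least [1 - 6/8 - 4/64 - 8/512 > 0]. *)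
  rewrite lerDl mulr_ge0 ?sqr_ge0//.
  have : x ^+ 2 <= 64^-1 by nra.
  have : x ^+ 3 <= 512^-1 by rewrite exprSr; nra.
  lra.
have K : expR (- x - 2 * x ^+ 2) <= Num.sqrt (1 - 2 * x).
  rewrite -(@ler_pXn2r _ 2)// ?nnegrE ?expR_ge0 ?sqrtr_ge0// sqr_sqrtr ?(ltW c0)//.
  rewrite (_ : - x - 2 * x ^+ 2 = - (2 * x ^+ 2 + x)); last by ring.
  rewrite expRN exprVn invf_ple ?posrE ?exprn_gt0 ?expR_gt0//.
  apply: le_trans (_ : (1 + (2 * x ^+ 2 + x)) ^+ 2 <= _).
    by rewrite -div1r ler_pdivrMr// mulrC.
  by rewrite lerXn2r ?nnegrE ?expR_ge0 ?expR_ge1Dx.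
rewrite mulrC ler_pdivrMr ?sqrtr_gt0//.
apply: le_trans (ler_wpM2l (expR_ge0 _) K).
by rewrite -expRD ler_expR; lra.
Qed.

(** * Pathwise error of thresholding *)

Section threshold_error.
Variable R : realType.
Implicit Types q s t y : R.

Lemma abs_pow_ge0 q s : 0 <= abs_pow q s.
Proof. by rewrite /abs_pow; case: ifP => _; rewrite ?ler0n ?powR_ge0. Qed.

Lemma abs_powE q s : s != 0 -> abs_pow q s = `|s| `^ q.
Proof. by rewrite /abs_pow => s0; case: eqVneq => [->|//]; rewrite s0 powRr0. Qed.

Lemma abs_pow_sqr q s : q < 2 -> s ^+ 2 = abs_pow q s * `|s| `^ (2 - q).
Proof.
move=> q2; have [->|s0] := eqVneq s 0.
  by rewrite normr0 powR0 ?mulr0 ?expr0n//; lra.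
rewrite abs_powE// -powRD; last by rewrite normr_eq0 s0 implybT.
by rewrite addrC subrK powR_mulrn// real_normK ?num_real.
Qed.

Lemma sqr_le_abs_pow q s t : 0 <= q -> 0 < t -> t <= `|s| ->
  t ^+ 2 <= abs_pow q s * t `^ (2 - q).
Proof.
move=> q0 t0 ts; have s0 : s != 0 by rewrite -normr_gt0; lra.
rewrite abs_powE//.
have -> : t ^+ 2 = t `^ q * t `^ (2 - q).
  rewrite -powRD; last by rewrite (gt_eqF t0) implybT.
  by rewrite addrC subrK powR_mulrn// ltW.
by rewrite ler_wpM2r ?powR_ge0// ge0_ler_powR// ?nnegrE// ltW.
Qed.

(** This controls the cross term of a kept entry. If [q <= 1], then [|s| <= |s|^q] and the first
    summand suffices. If [q > 1], then [y <= t = t^(q-1) t^(2-q) <= |s|^(q-1) t^(2-q)] and the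
    second one does. *)
Lemma norm_mul_le_abs_pow q s t y : 0 <= q -> 0 < t -> t <= `|s| -> `|s| <= 1 ->
  0 <= y <= t -> `|s| * y <= abs_pow q s * y + abs_pow q s * t `^ (2 - q).
Proof.
move=> q0 t0 ts s1 /andP[y0 yt].
have s0 : s != 0 by rewrite -normr_gt0; lra.
have ns0 : 0 < `|s| by rewrite normr_gt0.
have [q1|q1] := leP q 1.
  rewrite -[leLHS]addr0 lerD ?mulr_ge0 ?abs_pow_ge0 ?powR_ge0// ler_wpM2r//.
  by rewrite abs_powE// -[leLHS]powRr1// ger_powR// s1 ns0.
rewrite -[leLHS]add0r lerD ?mulr_ge0 ?abs_pow_ge0//.
apply: le_trans (_ : `|s| * t <= _); first by rewrite ler_wpM2l.
have -> : abs_pow q s = `|s| * `|s| `^ (q - 1).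
  rewrite abs_powE// -{2}[`|s|]powRr1// -powRD; last by rewrite (gt_eqF ns0) implybT.
  by rewrite addrC subrK.
have -> : `|s| * t = `|s| * (t `^ (q - 1) * t `^ (2 - q)).
  rewrite -powRD; last by rewrite (gt_eqF t0) implybT.
  by rewrite (_ : q - 1 + (2 - q) = 1) ?powRr1 ?(ltW t0)//; ring.
rewrite -mulrA ler_wpM2l// ler_wpM2r ?powR_ge0// ge0_ler_powR ?nnegrE//; lra.
Qed.

(** From [1 + y/4 <= exp (y/4)]. The exponent is halved because the error bound is squared later. *)
Lemma sqr_le_expR_half y : 0 <= y -> (3 / 2 + y) ^+ 2 <= 16 * expR (y / 2).
Proof.
move=> y0; have H : 3 / 2 + y <= 4 * expR (y / 4).
  by have := expR_ge1Dx (y / 4); lra.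
have -> : expR (y / 2) = expR (y / 4) ^+ 2.
  by rewrite -expRM_natl; congr expR; lra.
have -> : 16 * expR (y / 4) ^+ 2 = (4 * expR (y / 4)) ^+ 2 by ring.
by have := expR_ge0 (y / 4); rewrite lerXn2r ?nnegrE//; lra.
Qed.

Lemma threshold_sqr_error q t s h m :
    0 <= q -> q < 2 -> 0 < t -> t <= 2^-1 -> `|s| <= 1 -> 1 <= m ->
  `|(if 2 * t < `|h| then h else 0) ^+ 2 - s ^+ 2| <=
    9 * (abs_pow q s * t `^ (2 - q)) + 2 * (abs_pow q s * `|h - s|) +
    16 * expR (m * (`|h - s| - t) / 2).
Proof.
move=> q0 q2 t0 t12 s1 m1.
have w0 := abs_pow_ge0 q s; have T0 := powR_ge0 t (2 - q).
have wT0 := mulr_ge0 w0 T0.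
have wy0 := mulr_ge0 w0 (normr_ge0 (h - s)).
have e0 := expR_ge0 (m * (`|h - s| - t) / 2).
have hs : `|h| <= `|s| + `|h - s|.
  by rewrite (le_trans _ (ler_normD _ _))// addrC subrK.
have sh : `|s| <= `|h| + `|h - s|.
  by rewrite distrC (le_trans _ (ler_normD _ _))// addrC subrK.
have [yt|yt] := ltP t `|h - s|.
  (* Large deviation: both squares are at most [(1 + |h - s|)^2], and [t <= 1/2] gives
     [1 + |h - s| <= 3/2 + (|h - s| - t)]. *)
  have y0 : 0 <= `|h - s| - t by lra.
  have [K0 K1] : 0 <= `|h - s| /\ 0 <= `|s| by [].
  have K : (1 + `|h - s|) ^+ 2 <= 16 * expR (m * (`|h - s| - t) / 2).
    apply: le_trans (_ : (3 / 2 + (`|h - s| - t)) ^+ 2 <= _).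
      by rewrite lerXn2r ?nnegrE; lra.
    apply: (le_trans (sqr_le_expR_half y0)).
    by rewrite ler_wpM2l// ler_expR ler_wpM2r// ler_peMl.
  have s2 : s ^+ 2 <= (1 + `|h - s|) ^+ 2.
    by rewrite -[s ^+ 2]real_normK ?num_real// lerXn2r ?nnegrE//; lra.
  have h2 : (if 2 * t < `|h| then h else 0) ^+ 2 <= (1 + `|h - s|) ^+ 2.
    case: ifP => _; last by rewrite expr0n sqr_ge0.
    by rewrite -[h ^+ 2]real_normK ?num_real// lerXn2r ?nnegrE//; lra.
  have s20 := sqr_ge0 s; have h20 := sqr_ge0 (if 2 * t < `|h| then h else 0).
  by apply/ler_normlP; split; lra.
case: ifPn => [th|]; last rewrite -leNgt => ht.
  (* Kept entry: [|h| > 2 t] and [|h - s| <= t] force [|s| >= t], so [t^2] and the cross term are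
     both controlled by the weight. *)
  have ts : t <= `|s| by lra.
  have y0 : 0 <= `|h - s| <= t by rewrite normr_ge0.
  have A := sqr_le_abs_pow q0 t0 ts; have B := norm_mul_le_abs_pow q0 t0 ts s1 y0.
  have -> : h ^+ 2 - s ^+ 2 = (h - s) ^+ 2 + 2 * (s * (h - s)) by ring.
  apply: (le_trans (ler_normD _ _)); rewrite normrX !normrM.
  have : `|h - s| ^+ 2 <= t ^+ 2 by rewrite lerXn2r ?nnegrE ?(ltW t0).
  by rewrite (ger0_norm (ler0n _ 2)); lra.
rewrite expr0n/= sub0r normrN ger0_norm ?sqr_ge0// (abs_pow_sqr _ q2).
(* Discarded entry: [|s| <= 3 t], and [3^(2-q) <= 3^2] yields the constant 9. *)
suff : abs_pow q s * `|s| `^ (2 - q) <= 9 * (abs_pow q s * t `^ (2 - q)) by lra.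
rewrite mulrCA ler_wpM2l//.
apply: le_trans (_ : (3 * t) `^ (2 - q) <= _).
  by rewrite ge0_ler_powR ?nnegrE//; lra.
rewrite powRM ?(ltW t0)// ler_wpM2r//.
rewrite (_ : 9 = 3 `^ 2); last by rewrite powR_mulrn//; ring.
by rewrite ler_powR; lra.
Qed.

End threshold_error.

(** * Concentration of the empirical covariance *)

Section mean_bounds.
Context (R : realType) (d : measure_display) (T : measurableType d).
Variable P : probability T R.
Implicit Types (f g : T -> R) (c k : R).

(** Measurability and nonnegativity travel with the bound on the integral, so that bounds can be
    added, scaled and compared without side conditions on integrability. *)
Definition mean_le f c : Prop :=
  [/\ measurable_fun setT f, forall w, 0 <= f w &
      (\int[P]_w (f w)%:E <= c%:E)%E].

Lemma mean_le_cst c : 0 <= c -> mean_le (cst c) c.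
Proof.
move=> c0; split => //; rewrite (integral_cst P measurableT c%:E).
by rewrite [X in (_ * X)%E](@probability_setT _ _ _ P) mule1.
Qed.

Lemma mean_leD f g c k : mean_le f c -> mean_le g k ->
  mean_le (fun w => f w + g w) (c + k).
Proof.
move=> [mf f0 fc] [mg g0 gk]; split; first exact: measurable_funD.
  by move=> w; rewrite addr_ge0.
under eq_integral do rewrite EFinD.
rewrite ge0_integralD//; first by rewrite EFinD leeD.
all: by [exact/measurable_EFinP | move=> w _; rewrite lee_fin].
Qed.

Lemma mean_leZ f c k : 0 <= k -> mean_le f c -> mean_le (fun w => k * f w) (k * c).
Proof.
move=> k0 [mf f0 fc]; split; first exact: measurable_funM.
  by move=> w; rewrite mulr_ge0.
under eq_integral do rewrite EFinM.
rewrite ge0_integralZl ?lee_fin//; first by rewrite EFinM lee_wpmul2l ?lee_fin.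
all: by [exact/measurable_EFinP | move=> w _; rewrite lee_fin].
Qed.

Lemma mean_le_sum (I : Type) (s : seq I) (Q : pred I) (F : I -> T -> R) (C : I -> R) :
    (forall i, Q i -> mean_le (F i) (C i)) ->
  mean_le (fun w => \sum_(i <- s | Q i) F i w) (\sum_(i <- s | Q i) C i).
Proof.
move=> FC; elim: s => [|i s IH].
  rewrite big_nil (_ : (fun w => _) = cst 0); first exact: mean_le_cst.
  by apply/funext => w; rewrite big_nil.
rewrite big_cons; under eq_fun do rewrite big_cons.
by case: ifPn => // Qi; apply: mean_leD => //; exact: FC.
Qed.

Lemma mean_le_mono f g c k : measurable_fun setT g -> (forall w, 0 <= g w <= f w) ->
  c <= k -> mean_le f c -> mean_le g k.
Proof.
move=> mg gf ck [mf f0 fc]; have g0 w : 0 <= g w by case/andP: (gf w).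
split => //; apply: (@le_trans _ _ (\int[P]_w (f w)%:E)%E); last first.
  by rewrite (le_trans fc)// lee_fin.
apply: ge0_le_integral => //; try exact/measurable_EFinP.
- by move=> w _; rewrite lee_fin.
- by move=> w _; rewrite lee_fin; case/andP: (gf w).
Qed.

End mean_bounds.

(** * Exponential moments of sums of squared linear forms *)

Section covariance_concentration.
Context (R : realType) (d : measure_display) (T : measurableType d).
Variables (P : probability T R) (n p : nat) (S : 'M[R]_p).
Variable X : 'I_n -> {RV P >-> p.-tuple (measurableTypeR R)}.
Hypothesis hX : iid_gaussian P S X.

Definition lin_form (u : 'cV[R]_p) (x : p.-tuple R) : R := (u^T *m col_of_tuple x) 0 0.

Lemma measurable_lin_form u :
  measurable_fun setT (lin_form u : p.-tuple (measurableTypeR R) -> measurableTypeR R).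
Proof.
have -> : lin_form u = fun x => \sum_i u i 0 * tnth x i.
  by apply/funext => x; rewrite /lin_form mxE; apply: eq_bigr => i _; rewrite !mxE.
apply: measurable_sum => i; apply: measurable_funM => //.
exact: measurable_tnth.
Qed.

(** Independence turns the mean into an [n]-th power; each factor is a centred chi-square moment,
    bounded by [chi2_mgf_bound] at [x = a v]. *)
Lemma mean_le_expR_sum_sqr (u : 'cV[R]_p) (v a : R) :
    (u^T *m S *m u) 0 0 = v -> 0 <= v -> `|a * v| <= 8^-1 ->
  mean_le P (fun w => expR (a * \sum_k (lin_form u (X k w) ^+ 2 - v)))
    (expR (n%:R * (2 * (a * v) ^+ 2))).
Proof.
move=> uSu v0 av; have [indX gX] := hX.
have /ler_normlP[av1 av2] := av.
pose f (y : p.-tuple (measurableTypeR R)) :=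
  expR (- (a * v)) * expR (a * lin_form u y ^+ 2).
have mlX k : measurable_fun setT (fun w => lin_form u (X k w) : measurableTypeR R).
  by apply: measurableT_comp => //; exact: measurable_lin_form.
have mf : measurable_fun setT f.
  apply: measurable_funM => //.
  by apply: (measurableT_comp (@measurable_expR_sqr R a)); exact: measurable_lin_form.
have f0 y : 0 <= f y by rewrite mulr_ge0 ?expR_ge0.
have fE w : expR (a * \sum_k (lin_form u (X k w) ^+ 2 - v)) = \prod_k f (X k w).
  rewrite mulr_sumr expR_sum; apply: eq_bigr => k _.
  by rewrite /f -expRD mulrBr addrC.
have fm k : (\int[P]_w (f (X k w))%:E =
    ((Num.sqrt (1 - 2 * (a * v)))^-1 * expR (- (a * v)))%:E)%E.
  under eq_integral do rewrite EFinM.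
  rewrite ge0_integralZl ?lee_fin ?expR_ge0//; last first.
    apply/measurable_EFinP.
    exact: (measurableT_comp (@measurable_expR_sqr R a) (mlX k)).
  rewrite (@integral_gaussian_expR_sqr _ _ _ _ _ v) ?mulrA//.
  - by rewrite -EFinM mulrC.
  - exact: (mlX k).
  - by move=> B mB; rewrite -uSu; exact: gX.
  - by rewrite -mulrA; lra.
split => [|w|].
- under eq_fun do rewrite fE.
  by apply: measurable_prod_cond => k; exact: measurableT_comp.
- exact: expR_ge0.
under eq_integral do rewrite fE.
rewrite (@ge0_integral_indep_prod _ _ _ _ _ _ _ X (fun=> f) _ indX _ _ fm)//.
rewrite prodr_const card_ord lee_fin expRM_natl.
by rewrite lerXn2r ?nnegrE ?expR_ge0 ?mulr_ge0 ?invr_ge0 ?sqrtr_ge0 ?chi2_mgf_bound.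
Qed.

End covariance_concentration.

(** * Correlation matrices along sums and differences of two coordinates *)

Section correlation.
Context (R : realType) (p : nat) (S : 'M[R]_p).
Hypotheses (psdS : psdmx S) (diagS : diag_part S = 1%:M).

Definition pair_col (e : R) (i j : 'I_p) : 'cV[R]_p :=
  delta_mx i 0 + e *: delta_mx j 0.

Lemma tr_pair_col e i j :
  (pair_col e i j)^T = delta_mx 0 i + e *: delta_mx 0 j.
Proof. by rewrite linearD linearZ/= !trmx_delta. Qed.

Lemma quad_pair_col e i j : e ^+ 2 = 1 ->
  ((pair_col e i j)^T *m S *m pair_col e i j) 0 0 = 2 + 2 * e * S i j.
Proof.
move=> e2; have diag1 k : S k k = 1.
  by have /matrixP/(_ k k) := diagS; rewrite !mxE eqxx.
have symS : S j i = S i j by have /matrixP/(_ i j) := psdS.1; rewrite mxE.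
have dE k l : (delta_mx 0 k : 'rV[R]_p) *m S *m (delta_mx l 0 : 'cV[R]_p) =
    const_mx (S k l).
  by apply/matrixP => a b; rewrite -rowE -colE !mxE.
rewrite tr_pair_col /pair_col !mulmxDl !mulmxDr -!scalemxAl -!scalemxAr.
rewrite !dE !mxE !diag1 symS.
by transitivity (1 + 2 * e * S i j + e ^+ 2); [ring | rewrite e2; ring].
Qed.

(** Positivity along the sum and the difference of two basis vectors gives [2 + 2 S i j >= 0] and
    [2 - 2 S i j >= 0]. *)
Lemma norm_corr_le1 i j : `|S i j| <= 1.
Proof.
have := psdS.2 (pair_col 1 i j); have := psdS.2 (pair_col (- 1) i j).
rewrite !quad_pair_col ?sqrrN ?expr1n// => H1 H2.
by apply/ler_normlP; split; lra.
Qed.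

Lemma lin_form_pair_col e i j (x : p.-tuple R) :
  lin_form (pair_col e i j) x = tnth x i + e * tnth x j.
Proof.
rewrite /lin_form tr_pair_col mulmxDl -scalemxAl.
by rewrite -!rowE !mxE.
Qed.

End correlation.

Lemma empirical_covE (R : realType) (n p : nat) (x : 'I_n -> p.-tuple R) i j :
  empirical_cov x i j = n%:R^-1 * \sum_k tnth (x k) i * tnth (x k) j.
Proof.
rewrite mxE summxE; congr (_ * _); apply: eq_bigr => k _.
by rewrite mxE big_ord1 !mxE.
Qed.

(** * Deviation of one entry of the empirical covariance *)

Section covariance_deviation.
Context (R : realType) (d : measure_display) (T : measurableType d).
Variables (P : probability T R) (n p : nat) (S : 'M[R]_p).
Variable X : 'I_n -> {RV P >-> p.-tuple (measurableTypeR R)}.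
Hypotheses (n0 : (0 < n)%N) (hX : iid_gaussian P S X).
Hypotheses (psdS : psdmx S) (diagS : diag_part S = 1%:M).

Definition cov_dev i j w : R := empirical_cov (fun k => X k w) i j - S i j.

Lemma measurable_empirical_cov i j :
  measurable_fun setT (fun w => empirical_cov (fun k => X k w) i j).
Proof.
under eq_fun do rewrite empirical_covE.
apply: measurable_funM => //; apply: measurable_sum => k.
have mXi l : measurable_fun setT (fun w => tnth (X k w) l : measurableTypeR R).
  exact: (measurableT_comp (measurable_tnth l)).
by apply: measurable_funM; exact: mXi.
Qed.

Lemma measurable_cov_dev i j : measurable_fun setT (cov_dev i j).
Proof. by apply: measurable_funB => //; exact: measurable_empirical_cov. Qed.

Let quad_dev e i j w : R :=
  \sum_k (lin_form (pair_col e i j) (X k w) ^+ 2 - (2 + 2 * e * S i j)).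

(** The centrings of the two quadratic sums differ by [4 S i j] per observation, which matches the
    polarized product. *)
Let cov_dev_polarization i j w :
  n%:R * cov_dev i j w = 4^-1 * (quad_dev 1 i j w - quad_dev (- 1) i j w).
Proof.
have nn0 : n%:R != 0 :> R by rewrite pnatr_eq0 -lt0n.
rewrite /cov_dev empirical_covE mulrBr mulrA divff// mul1r /quad_dev -sumrB mulr_sumr.
have -> : n%:R * S i j = \sum_(k < n) S i j by rewrite sumr_const card_ord mulr_natl.
rewrite -sumrB; apply: eq_bigr => k _; rewrite !lin_form_pair_col.
by field.
Qed.

(* The two halves of the polarization are dependent; AM-GM separates them, at
   the price of doubling the exponents. *)
Let mean_le_expR_cov_dev_signed i j (l : R) : `|l| <= 16^-1 ->
  mean_le P (fun w => expR (n%:R * l * cov_dev i j w)) (expR (8 * n%:R * l ^+ 2)).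
Proof.
move=> l16.
have S1 := norm_corr_le1 psdS diagS i j; have /ler_normlP[S1n S1p] := S1.
have quad_bound e a : e ^+ 2 = 1 -> `|e| = 1 -> `|a| = `|l| / 2 ->
    mean_le P (fun w => expR (a * quad_dev e i j w)) (expR (8 * n%:R * l ^+ 2)).
  move=> e2 e1 al.
  have eS : `|e * S i j| <= 1 by rewrite normrM e1 mul1r.
  have /ler_normlP[eS1 eS2] := eS.
  have v0 : 0 <= 2 + 2 * e * S i j by lra.
  (* The variance is at most 4, whence [|a v| <= 2 |l| <= 1/8]: this fixes the range [|l| <= 1/16]
     and the exponent [2 (2 l)^2 = 8 l^2]. *)
  have av : `|a * (2 + 2 * e * S i j)| <= 2 * `|l|.
    rewrite normrM al (ger0_norm v0); have := normr_ge0 l; nra.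
  have quadE := quad_pair_col psdS diagS i j e2.
  apply: mean_le_mono (mean_le_expR_sum_sqr hX quadE v0 _).
  - apply: measurableT_comp => //; apply: measurable_funM => //.
    apply: measurable_sum => k; apply: measurable_funB => //.
    apply: measurable_funX.
    by apply: (measurableT_comp (@measurable_lin_form R p _)).
  - by move=> w; apply/andP; split; [exact: expR_ge0|exact: lexx].
  - rewrite ler_expR (_ : 8 * n%:R * l ^+ 2 = n%:R * (8 * l ^+ 2)); last by ring.
    rewrite ler_wpM2l//.
    rewrite -[(a * _) ^+ 2]real_normK ?num_real// -[l ^+ 2]real_normK ?num_real//.
    have : `|a * (2 + 2 * e * S i j)| ^+ 2 <= (2 * `|l|) ^+ 2.
      by rewrite lerXn2r ?nnegrE ?mulr_ge0.
    by rewrite exprMn; lra.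
  - by apply: (le_trans av); lra.
(* Polarization carries the coefficient [l / 4], which AM-GM doubles to [l / 2]. *)
have l2 : `|l / 2| = `|l| / 2 by rewrite normrM [`|2^-1|]ger0_norm.
have A := quad_bound 1 (l / 2) (expr1n _ _) (normr1 _) l2.
have B : mean_le P (fun w => expR (- (l / 2) * quad_dev (- 1) i j w))
    (expR (8 * n%:R * l ^+ 2)).
  by apply: quad_bound; rewrite ?normrN ?normr1// sqrrN expr1n.
apply: mean_le_mono (mean_leZ (k := 2^-1) _ (mean_leD A B)) => //.
- apply: measurableT_comp => //; apply: measurable_funM => //.
  exact: measurable_cov_dev.
- move=> w; rewrite expR_ge0/= mulrAC cov_dev_polarization.
  set a := quad_dev _ _ _ _; set b := quad_dev _ _ _ _.
  have -> : 4^-1 * (a - b) * l = (l / 2 * a) / 2 + (- (l / 2) * b) / 2 by field.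
  have sqrE (x : R) : expR x = expR (x / 2) ^+ 2.
    by rewrite -expRM_natl; congr expR; field.
  rewrite expRD [expR (_ * a)]sqrE [expR (_ * b)]sqrE.
  have := sqr_ge0 (expR (l / 2 * a / 2) - expR (- (l / 2) * b / 2)).
  by rewrite sqrrB; lra.
- by lra.
Qed.

(** [exp |x| <= exp x + exp (-x)]: the two signs account for the factor 2. *)
Lemma mean_le_expR_cov_dev i j (l : R) : 0 <= l <= 16^-1 ->
  mean_le P (fun w => expR (n%:R * l * `|cov_dev i j w|)) (2 * expR (8 * n%:R * l ^+ 2)).
Proof.
move=> /andP[l0 l16].
have A : mean_le P (fun w => expR (n%:R * l * cov_dev i j w)) (expR (8 * n%:R * l ^+ 2)).
  by apply: mean_le_expR_cov_dev_signed; rewrite ger0_norm.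
have B : mean_le P (fun w => expR (n%:R * - l * cov_dev i j w))
    (expR (8 * n%:R * l ^+ 2)).
  by rewrite -[l ^+ 2]sqrrN; apply: mean_le_expR_cov_dev_signed; rewrite normrN ger0_norm.
apply: mean_le_mono (mean_leD A B).
- apply: measurableT_comp => //; apply: measurable_funM => //.
  by apply: measurableT_comp => //; exact: measurable_cov_dev.
- move=> w; rewrite expR_ge0/=; have := expR_ge0 (n%:R * l * cov_dev i j w).
  have := expR_ge0 (n%:R * - l * cov_dev i j w).
  by case: (ger0P (cov_dev i j w)) => _; rewrite ?mulrN -?mulNr ?mulrN; lra.
- by lra.
Qed.

Lemma mean_le_sqr_cov_dev i j :
  mean_le P (fun w => cov_dev i j w ^+ 2) (4096 / n%:R).
Proof.
have nn0 : 0 < n%:R :> R by rewrite ltr0n.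
have rn0 : 0 < Num.sqrt n%:R :> R by rewrite sqrtr_gt0.
have rn2 : Num.sqrt n%:R ^+ 2 = n%:R :> R by rewrite sqr_sqrtr// ltW.
have rn1 : 1 <= Num.sqrt n%:R :> R.
  have n1 : 1 <= n%:R :> R by rewrite ler1n.
  by have := ler_wsqrtr n1; rewrite sqrtr1.
pose l : R := (16 * Num.sqrt n%:R)^-1.
have l16 : 0 <= l <= 16^-1.
  by rewrite invr_ge0 mulr_ge0 ?sqrtr_ge0//= lef_pV2 ?posrE ?mulr_gt0// ler_peMr.
have nl : n%:R * l = Num.sqrt n%:R / 16.
  by rewrite -[in LHS]rn2 /l; field; rewrite gt_eqF.
have nl2 : 8 * n%:R * l ^+ 2 = 32^-1.
  by rewrite -[in LHS]rn2 /l; field; rewrite gt_eqF.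
(* With [z = n l |dev|], [n dev^2 = 1024 (z/2)^2 <= 1024 exp z]; the mean of [exp z] is at most
   [2 exp (1/32) <= 4]. *)
apply: mean_le_mono (mean_leZ (k := 1024 / n%:R) _ (mean_le_expR_cov_dev i j l16)).
- by apply: measurable_funX; exact: measurable_cov_dev.
- move=> w; rewrite sqr_ge0/= mulrAC ler_pdivlMr// -[X in _ * X]rn2 nl.
  set y := `|cov_dev i j w|; set z := Num.sqrt n%:R / 16 * y.
  have z0 : 0 <= z by rewrite /z /y !mulr_ge0 ?sqrtr_ge0 ?invr_ge0.
  have -> : cov_dev i j w ^+ 2 * Num.sqrt n%:R ^+ 2 = 1024 * (z / 2) ^+ 2.
    by rewrite -[cov_dev i j w ^+ 2]real_normK ?num_real// /z /y; field.
  have -> : expR z = expR (z / 2) ^+ 2 by rewrite -expRM_natl; congr expR; field.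
  apply: ler_wpM2l; first exact: ler0n.
  have z20 : 0 <= z / 2 by rewrite divr_ge0.
  rewrite lerXn2r ?nnegrE ?expR_ge0//.
  by apply: le_trans (expR_ge1Dx _); rewrite lerDr.
- rewrite nl2 mulrAC ler_wpM2r ?invr_ge0 ?(ltW nn0)//.
  suff : expR (32^-1) <= 2 :> R by lra.
  have := expR_ge1Dx (- 32^-1 : R); rewrite expRN => H.
  by rewrite -[leLHS]invrK invf_ple ?posrE ?invr_gt0 ?expR_gt0//; lra.
- by apply: divr_ge0; exact: ler0n.
Qed.

(** Chernoff's method: [l = t / 16] minimizes [8 n l^2 - n l t], with minimum [- n t^2 / 32], and
    [t <= 1] keeps [l] in the allowed range. *)
Lemma mean_le_expR_cov_dev_excess i j (t : R) : 0 <= t <= 1 ->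
  mean_le P (fun w => expR (n%:R * (t / 16) * (`|cov_dev i j w| - t)))
    (2 * expR (- (n%:R * t ^+ 2 / 32))).
Proof.
move=> /andP[t0 t1].
have l16 : 0 <= t / 16 <= 16^-1 by apply/andP; split; lra.
apply: mean_le_mono (mean_leZ (k := expR (- (n%:R * (t / 16) * t))) (expR_ge0 _)
  (mean_le_expR_cov_dev i j l16)).
- apply: measurableT_comp => //; apply: measurable_funM => //.
  apply: measurable_funB => //.
  by apply: measurableT_comp => //; exact: measurable_cov_dev.
- by move=> w; rewrite expR_ge0/= -expRD mulrBr addrC.
- rewrite mulrCA -expRD ler_wpM2l// ler_expR.
  by rewrite le_eqVlt; apply/orP; left; apply/eqP; field.
Qed.

End covariance_deviation.

(** * Risk of the plug-in estimator *)

(** Weighted Cauchy-Schwarz, read off from the nonnegative weighted second moment of [a] about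
    [A / r]. *)
Lemma sqr_wsum_le (R : realFieldType) (I : Type) (s : seq I) (Q : pred I)
    (w a : I -> R) (r : R) :
    0 < r -> (forall i, 0 <= w i) -> \sum_(i <- s | Q i) w i <= r ->
  (\sum_(i <- s | Q i) w i * a i) ^+ 2 <= r * \sum_(i <- s | Q i) w i * a i ^+ 2.
Proof.
move=> r0 w0 wr; set A := \sum_(i <- s | Q i) w i * a i.
set B := \sum_(i <- s | Q i) w i * a i ^+ 2; pose m := A / r.
have : 0 <= \sum_(i <- s | Q i) w i * (a i - m) ^+ 2.
  by apply: sumr_ge0 => i _; rewrite mulr_ge0 ?sqr_ge0.
have -> : \sum_(i <- s | Q i) w i * (a i - m) ^+ 2 =
    B - 2 * m * A + m ^+ 2 * \sum_(i <- s | Q i) w i.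
  rewrite /A /B !mulr_sumr -sumrB -big_split/=.
  by apply: eq_bigr => i _; ring.
have mA : m * A = A ^+ 2 / r by rewrite /m; field; rewrite gt_eqF.
have : m ^+ 2 * (\sum_(i <- s | Q i) w i) <= m ^+ 2 * r by rewrite ler_wpM2l ?sqr_ge0.
have -> : m ^+ 2 * r = A ^+ 2 / r by rewrite /m; field; rewrite gt_eqF.
by move=> H1 H2; rewrite -ler_pdivrMl// mulrC; lra.
Qed.

Lemma Qfun_pair (R : realType) (p : nat) (A : 'M[R]_p) :
  Qfun A = \sum_(k : 'I_p * 'I_p | k.1 != k.2) A k.1 k.2 ^+ 2.
Proof. by rewrite /Qfun pair_big_dep. Qed.

Lemma measurable_hard_threshold (R : realType) (tau : R) :
  measurable_fun [set: R] (fun h : R => if tau < `|h| then h else 0).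
Proof.
apply: measurable_fun_ifT => //.
by apply: measurable_fun_ltr => //; exact: measurableT_comp.
Qed.

Lemma sqrD3_le (R : realFieldType) (a b c : R) :
  (a + b + c) ^+ 2 <= 3 * (a ^+ 2 + b ^+ 2 + c ^+ 2).
Proof.
have := sqr_ge0 (a - b); have := sqr_ge0 (b - c); have := sqr_ge0 (a - c); nra.
Qed.

Section plug_in_risk.
Context (R : realType) (d : measure_display) (T : measurableType d).
Variables (P : probability T R) (n p : nat) (S : 'M[R]_p).
Variable X : 'I_n -> {RV P >-> p.-tuple (measurableTypeR R)}.
Variables (q r t : R).
Hypotheses (n0 : (0 < n)%N) (p0 : (0 < p)%N) (hX : iid_gaussian P S X).
Hypotheses (q0 : 0 <= q) (q2 : q < 2) (r0 : 0 < r) (hS : sparse_class q r S).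
Hypotheses (t0 : 0 < t) (t12 : t <= 2^-1) (nt : 1 <= n%:R * (t / 16)).

Let offdiag (k : 'I_p * 'I_p) := k.1 != k.2.
Let wgt (k : 'I_p * 'I_p) := abs_pow q (S k.1 k.2).
Let dev (k : 'I_p * 'I_p) := cov_dev S X k.1 k.2.
Let excess (k : 'I_p * 'I_p) w : R := n%:R * (t / 16) * (`|dev k w| - t).
Let err w : R :=
  Qfun (threshold_mx (2 * t) (empirical_cov (fun k => X k w))) - Qfun S.

Let errE w : err w = \sum_(k | offdiag k)
  ((if 2 * t < `|empirical_cov (fun k => X k w) k.1 k.2|
    then empirical_cov (fun k => X k w) k.1 k.2 else 0) ^+ 2 - S k.1 k.2 ^+ 2).
Proof.
rewrite /err !Qfun_pair -sumrB; apply: eq_bigr => k /negbTE kd.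
by rewrite mxE kd.
Qed.

Let sum_wgt : \sum_(k | offdiag k) wgt k <= r.
Proof.
by case: hS => _ h _; apply: le_trans h; rewrite pair_big_dep.
Qed.

Let sum_offdiag : \sum_(k | offdiag k) 1 <= p%:R ^+ 2 :> R.
Proof.
rewrite big_mkcond/=; apply: (@le_trans _ _ (\sum_(k : 'I_p * 'I_p) 1)).
  by apply: ler_sum => k _; case: ifP.
by rewrite sumr_const card_prod card_ord natrM expr2.
Qed.

(** The factor 1 in the last sum is a weight: both sums then have the shape required by
    [sqr_wsum_le]. *)
Let norm_err_le w : `|err w| <= 9 * (r * t `^ (2 - q)) +
  2 * \sum_(k | offdiag k) wgt k * `|dev k w| +
  16 * \sum_(k | offdiag k) 1 * expR (excess k w / 2).
Proof.
rewrite errE; apply: (le_trans (ler_norm_sum _ _ _)).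
have [psdS _ diagS] := hS.
apply: (@le_trans _ _ (\sum_(k | offdiag k) (9 * (wgt k * t `^ (2 - q)) +
    2 * (wgt k * `|dev k w|) + 16 * (1 * expR (excess k w / 2))))).
  apply: ler_sum => k _; rewrite mul1r.
  by apply: threshold_sqr_error => //; exact: norm_corr_le1.
rewrite !big_split/= -!mulr_sumr -mulr_suml !lerD2r.
apply: ler_wpM2l; first exact: ler0n.
by apply: ler_wpM2r; rewrite ?powR_ge0.
Qed.

(** Cauchy-Schwarz is applied twice, with the sparsity weights of total at most [r] and with unit
    weights of total at most [p^2]; 81, 4 and 256 are the squares of 9, 2 and 16. *)
Let sqr_err_le w : err w ^+ 2 <= 3 * (81 * (r * t `^ (2 - q)) ^+ 2 +
  (4 * (r * \sum_(k | offdiag k) wgt k * dev k w ^+ 2) +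
   256 * (p%:R ^+ 2 * \sum_(k | offdiag k) expR (excess k w)))).
Proof.
rewrite -[err w ^+ 2]real_normK ?num_real//.
set a := r * t `^ (2 - q).
have a0 : 0 <= a by rewrite mulr_ge0 ?powR_ge0 ?(ltW r0).
pose b := \sum_(k | offdiag k) wgt k * `|dev k w|.
pose c := \sum_(k | offdiag k) 1 * expR (excess k w / 2).
have b2 : b ^+ 2 <= r * \sum_(k | offdiag k) wgt k * dev k w ^+ 2.
  have := @sqr_wsum_le R _ (index_enum _) offdiag wgt (fun k => `|dev k w|) r r0.
  move=> /(_ (fun k => abs_pow_ge0 _ _) sum_wgt) /le_trans; apply.
  apply: ler_wpM2l; first exact: ltW.
  by apply: ler_sum => k _; rewrite real_normK ?num_real.
have pp0 : 0 < p%:R ^+ 2 :> R by rewrite exprn_gt0// ltr0n.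
have c2 : c ^+ 2 <= p%:R ^+ 2 * \sum_(k | offdiag k) expR (excess k w).
  have := @sqr_wsum_le R _ (index_enum _) offdiag (fun=> 1)
    (fun k => expR (excess k w / 2)) _ pp0.
  move=> /(_ (fun=> ler01) sum_offdiag) /le_trans; apply.
  apply: ler_wpM2l; first exact: ltW.
  apply: ler_sum => k _; rewrite mul1r -expRM_natl.
  by rewrite le_eqVlt; apply/orP; left; apply/eqP; congr expR; field.
have H : `|err w| <= 9 * a + 2 * b + 16 * c by exact: norm_err_le.
apply: le_trans (_ : (9 * a + 2 * b + 16 * c) ^+ 2 <= _).
  rewrite lerXn2r ?nnegrE//; exact: le_trans H.
apply: (le_trans (sqrD3_le _ _ _)).
by rewrite !exprMn; lra.
Qed.

(** Of the two factors [p^2], one comes from Cauchy-Schwarz and the other from summing over the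
    entries. *)
Lemma mean_le_sqr_err :
  mean_le P (fun w => (Qfun (threshold_mx (2 * t) (empirical_cov (fun k => X k w)))
                       - Qfun S) ^+ 2)
    (3 * (81 * (r * t `^ (2 - q)) ^+ 2 + (4 * (r * (r * (4096 / n%:R))) +
      256 * (p%:R ^+ 2 * (p%:R ^+ 2 * (2 * expR (- (n%:R * t ^+ 2 / 32)))))))).
Proof.
have [psdS _ diagS] := hS.
have c0 (m : nat) : 0 <= m%:R :> R by exact: ler0n.
have D : mean_le P (fun w => \sum_(k | offdiag k) wgt k * dev k w ^+ 2)
    (r * (4096 / n%:R)).
  apply: mean_le_mono (mean_le_sum (index_enum _)
    (fun k (_ : offdiag k) => mean_leZ (abs_pow_ge0 q (S k.1 k.2))
      (mean_le_sqr_cov_dev n0 hX psdS diagS k.1 k.2))).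
  - apply: measurable_sum_cond => k; apply: measurable_funM => //.
    by apply: measurable_funX; exact: measurable_cov_dev.
  - move=> w; apply/andP; split; last exact: lexx.
    by apply: sumr_ge0 => k _; rewrite mulr_ge0 ?abs_pow_ge0 ?sqr_ge0.
  - rewrite -mulr_suml; apply: ler_wpM2r sum_wgt.
    by apply: divr_ge0; exact: ler0n.
have t01 : 0 <= t <= 1.
  by rewrite ltW//= (le_trans t12)// invf_le1// ler1n.
have E : mean_le P (fun w => \sum_(k | offdiag k) expR (excess k w))
    (p%:R ^+ 2 * (2 * expR (- (n%:R * t ^+ 2 / 32)))).
  apply: mean_le_mono (mean_le_sum (index_enum _) (fun k (_ : offdiag k) =>
    mean_le_expR_cov_dev_excess n0 hX psdS diagS k.1 k.2 t01)).
  - apply: measurable_sum_cond => k; apply: measurableT_comp => //.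
    apply: measurable_funM => //; apply: measurable_funB => //.
    by apply: measurableT_comp => //; exact: measurable_cov_dev.
  - move=> w; apply/andP; split; last exact: lexx.
    by apply: sumr_ge0 => k _; exact: expR_ge0.
  - rewrite -[X in \sum_(k | _) X]mul1r -mulr_suml; apply: ler_wpM2r sum_offdiag.
    by rewrite mulr_ge0 ?expR_ge0.
have A : mean_le P (cst (81 * (r * t `^ (2 - q)) ^+ 2)) (81 * (r * t `^ (2 - q)) ^+ 2).
  by apply: mean_le_cst; apply: mulr_ge0; [exact: c0|exact: sqr_ge0].
apply: mean_le_mono (mean_leZ (c0 3) (mean_leD A (mean_leD
  (mean_leZ (c0 4) (mean_leZ (ltW r0) D))
  (mean_leZ (c0 256) (mean_leZ (exprn_ge0 2 (c0 p)) E))))); last exact: lexx.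
- apply: measurable_funX; under eq_fun do rewrite -/(err _) errE.
  apply: measurable_sum_cond => k; apply: measurable_funB => //.
  apply: measurable_funX.
  apply: (measurableT_comp (@measurable_hard_threshold R (2 * t))).
  exact: measurable_empirical_cov.
- move=> w; rewrite sqr_ge0; exact: sqr_err_le.
Qed.

End plug_in_risk.

(** * Choice of constants and conclusion *)

Lemma Qfun_le1 (R : realType) (p : nat) (A : 'M[R]_p) : (p <= 1)%N -> Qfun A = 0.
Proof.
move=> p1; have o0 (k : 'I_p) : (k : nat) = 0%N.
  by apply/eqP; rewrite -leqn0 -ltnS (leq_trans (ltn_ord k)).
rewrite /Qfun big1// => i _; rewrite big1// => j; case/negP.
by apply/eqP/val_inj; rewrite /= !o0.
Qed.

Lemma natr_powR (R : realType) (p : nat) (x : R) : (0 < p)%N ->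
  p%:R `^ x = expR (x * ln p%:R).
Proof. by move=> p0; rewrite /powR pnatr_eq0 eqn0Ngt p0. Qed.

Theorem theorem3p1 (R : realType) (gamma C0 q : R)
    (hgamma : 8 < gamma) (hC0 : 4 <= C0) (hq0 : 0 <= q) (hq2 : q < 2) :
  exists C1 C2 : R, [/\ 0 < C1, 0 < C2 &
    forall (n p : nat) (hn : (0 < n)%N) (hp : (0 < p)%N)
      (hlog : gamma * ln p%:R < n%:R)
      (htau : tau_np gamma C0 n p <= 1)
      (r : R) (hr : 0 < r)
      (S : 'M[R]_p) (hS : sparse_class q r S)
      (d : measure_display) (T : measurableType d) (P : probability T R)
      (X : 'I_n -> {RV P >-> p.-tuple (measurableTypeR R)})
      (hX : iid_gaussian P S X),
    ('E_P[fun w => ((Qfun (threshold_mx (tau_np gamma C0 n p)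
                             (empirical_cov (fun k => X k w)))
                     - Qfun S) ^+ 2)%R]
     <= (C1 * psi_np q r n p + C2 * p%:R `^ (4 - gamma / 2))%:E)%E].
Proof.
(* [K] is the factor relating [(t^(2-q))^2 = (t^2)^(2-q)] to [(ln p / n)^(2-q)], since
   [t^2 = C0^2 gamma ln p / n]. *)
pose K : R := (C0 ^+ 2 * gamma) `^ (2 - q).
have K0 : 0 <= K by exact: powR_ge0.
have c0 (m : nat) : 0 <= m%:R :> R by exact: ler0n.
exists (3 * (81 * K + 4 * 4096)), (3 * (256 * 2)); split.
- by do ?[rewrite ltr0n|apply: mulr_gt0|apply: ltr_wpDl|apply: mulr_ge0 K0|exact: c0].
- by do ?[rewrite ltr0n|apply: mulr_gt0].
move=> n p hn hp hlog htau r hr S hS d T P X hX.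
have psi1 : r ^+ 2 / n%:R <= psi_np q r n p by rewrite /psi_np le_max lexx.
have psi2 : r ^+ 2 * (ln p%:R / n%:R) `^ (2 - q) <= psi_np q r n p.
  by rewrite /psi_np le_max lexx orbT.
have nn0 : 0 < n%:R :> R by rewrite ltr0n.
(* At [p = 1] the threshold is 0, outside the range of the risk bound, but there are no off-diagonal
   entries and the error vanishes. *)
have [p1|p1] := leqP p 1.
  rewrite unlock; under eq_integral do rewrite !Qfun_le1// subr0 expr0n.
  rewrite integral0 lee_fin.
  have psi0 : 0 <= psi_np q r n p by apply: le_trans psi1; rewrite divr_ge0 ?sqr_ge0.
  by apply: addr_ge0; do ?[exact: psi0|exact: powR_ge0|exact: c0|exact: K0|
    apply: mulr_ge0|apply: addr_ge0].
set L := ln p%:R : R in hlog psi1 psi2 *.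
(* [exp (-1/2) >= 1/2] gives [exp (1/2) <= 2 <= p]; with [gamma > 8] this yields [gamma L >= 4]. *)
have L12 : 2^-1 <= L.
  have p2 : 2 <= p%:R :> R by rewrite ler_nat.
  rewrite -[2^-1]expRK ler_ln ?posrE ?expR_gt0 ?ltr0n//; apply: le_trans p2.
  have := expR_ge1Dx (- 2^-1 : R); rewrite expRN => H.
  by rewrite -[leLHS]invrK invf_ple ?posrE ?invr_gt0 ?expR_gt0//; lra.
have L0 : 0 < L by exact: lt_le_trans L12.
have gamma0 : 0 < gamma by exact: lt_trans hgamma.
have C00 : 0 < C0 by exact: lt_le_trans hC0.
pose t := C0 * Num.sqrt (gamma * L / n%:R).
have gLn0 : 0 < gamma * L / n%:R by rewrite divr_gt0// mulr_gt0.
have t0 : 0 < t by rewrite mulr_gt0 ?sqrtr_gt0.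
have tauE : tau_np gamma C0 n p = 2 * t by rewrite /tau_np -mulrA.
have t12 : t <= 2^-1 by move: htau; rewrite tauE; lra.
have t2 : t ^+ 2 = C0 ^+ 2 * gamma * (L / n%:R).
  by rewrite exprMn sqr_sqrtr ?(ltW gLn0)//; ring.
have nt2 : n%:R * t ^+ 2 = C0 ^+ 2 * gamma * L.
  by rewrite t2; field; rewrite gt_eqF.
have C02 : 16 <= C0 ^+ 2 by nra.
have gL : 16 * (gamma * L) <= n%:R * t ^+ 2.
  by rewrite nt2 -[leRHS]mulrA ler_wpM2r// mulr_ge0// ltW.
have gL4 : 4 <= gamma * L by nra.
(* As [t <= 1], [n t >= n t^2 >= 16 gamma L >= 64]. *)
have nt : 1 <= n%:R * (t / 16).
  have : n%:R * t ^+ 2 <= n%:R * t.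
    by rewrite ler_wpM2l// expr2 ler_piMl ?(ltW t0)// (le_trans t12)// invf_le1// ler1n.
  by lra.
have [_ _ risk] := mean_le_sqr_err hn hp hX hq0 hq2 hr hS t0 t12 nt.
rewrite unlock tauE; apply: (le_trans risk); rewrite lee_fin.
have T2 : (t `^ (2 - q)) ^+ 2 = K * (L / n%:R) `^ (2 - q).
  rewrite expr2 -powRM ?(ltW t0)// -expr2 t2 powRM//.
  - by rewrite mulr_ge0 ?sqr_ge0// ltW.
  - by rewrite divr_ge0// ltW.
(* [C0 >= 4] gives [n t^2 / 32 >= gamma L / 2], while [p^4 = exp (4 L)]. *)
have pexp : p%:R ^+ 2 * (p%:R ^+ 2 * expR (- (n%:R * t ^+ 2 / 32))) <=
    p%:R `^ (4 - gamma / 2).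
  rewrite mulrA -exprD natr_powR// -[p%:R ^+ _]powR_mulrn// natr_powR//.
  rewrite -expRD ler_expR -/L.
  by lra.
have B1 : 81 * (r * t `^ (2 - q)) ^+ 2 <= 81 * K * psi_np q r n p.
  rewrite exprMn T2; set x := (L / n%:R) `^ (2 - q).
  rewrite (_ : 81 * (r ^+ 2 * (K * x)) = 81 * K * (r ^+ 2 * x)); last by ring.
  by apply: ler_wpM2l psi2; apply: mulr_ge0 => //; exact: c0.
have B2 c : 0 <= c -> 4 * (r * (r * (c / n%:R))) <= 4 * c * psi_np q r n p.
  move=> cge0.
  rewrite (_ : 4 * (r * (r * (c / n%:R))) = 4 * c * (r ^+ 2 / n%:R)); last by ring.
  by apply: ler_wpM2l psi1; rewrite mulr_ge0.
set e := expR _ in pexp *; set N := p%:R ^+ 2 in pexp *.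
have -> : 256 * (N * (N * (2 * e))) = 256 * 2 * (N * (N * e)) by ring.
rewrite [leRHS](_ : _ = 3 * (81 * K * psi_np q r n p +
  (4 * 4096 * psi_np q r n p + 256 * 2 * p%:R `^ (4 - gamma / 2)))); last by ring.
apply: ler_wpM2l; first exact: c0.
apply: lerD B1 (lerD (B2 _ (c0 _)) _).
by apply: ler_wpM2l pexp; apply: mulr_ge0; exact: c0.
Qed.
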